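(* Let $S_\lambda \in \mathcal{B}(\ell^2(V))$ be a $\ast$-paranormal weighted shift on $\ell^2(V)$ with weights $(\lambda_v)_{v\in V^0}$. Then $$\left(\sum_{u\in V} \left|\sum_{v\in chi(u)}\overline{\lambda_v}f(v)\right|^2\right)^2 \leq \left(\sum_{u\in V}\|S_{\lambda}^2e_u\|^2 |f(u)|^2\right)\left(\sum_{u\in V}|f(u)|^2\right)$$ for every $f \in \ell^2(V)$.
   Context: $G=(V,E)$ is a directed graph in which every vertex $v$ has at most one parent: $(u,v)\in E\subset V\times V$ means $u=par(v)$ is the parent of $v$, and $v$ is a child of $u$; $chi(u)$ denotes the set of children of $u$. A vertex with no parent is a root, and $V^0$ is $V$ minus the set of roots. $\ell^2(V)$ is the Hilbert space of square summable complex functions on $V$ with orthonormal basis $\{e_u\}_{u\in V}$, $e_u(v)=1$ if $v=u$ and $0$ otherwise. For complex weights $(\lambda_v)_{v\in V^0}$, the weighted shift $S_\lambda$ is given by $(S_\lambda f)(v)=\lambda_v f(par(v))$ if $v$ is not a root and $(S_\lambda f)(v)=0$ if $v$ is a root. $\mathcal{B}(\mathcal{H})$ denotes the bounded linear operators on a Hilbert space $\mathcal{H}$. An operator $T\in\mathcal{B}(\mathcal{H})$ is $\ast$-paranormal if $\|T^*x\|^2\le\|T^2x\|\,\|x\|$ for all $x\in\mathcal{H}$. *)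

(* Defs.v *)
From HB Require Import structures.
From mathcomp Require Import all_boot all_order all_algebra.
From mathcomp Require Import complex ring.
From mathcomp Require Import all_classical all_reals all_analysis.
(* [sum x]: the unordered sum of a family, i.e. the limit of its finite partial
   sums along the inclusion of finite sets *)
From mathcomp Require Import summability.
Import Order.TTheory GRing.Theory Num.Theory.
Import numFieldNormedType.Exports.

Set Implicit Arguments.
Unset Strict Implicit.
Unset Printing Implicit Defensive.

Local Open Scope classical_set_scope.
Local Open Scope complex_scope.
Local Open Scope ring_scope.

Section Graph.
Context {V : choiceType}.
Implicit Types (E : set (V * V)) (u v : V).

Definition at_most_one_parent E : Prop :=
  forall u u' v, E (u, v) -> E (u', v) -> u = u'.

Definition chi E u : set V := [set v | E (u, v)].

Definition nonroot E : set V := [set v | exists u, E (u, v)].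

(* junk value v when v is a root *)
Definition par E v : V := xget v [set u | E (u, v)].

End Graph.

Section Ell2.
Context {R : realType}.
Local Notation C := R[i].

(* real-valued, whereas `|z| lives in C *)
Definition cabs (z : C) : R := ComplexField.Normc.normc z.

Lemma cabsE z : `|z| = (cabs z)%:C.
Proof. by []. Qed.

Lemma cabs0 : cabs 0 = 0.
Proof. exact: ComplexField.Normc.normc0. Qed.

Lemma cabsM z w : cabs (z * w) = cabs z * cabs w.
Proof. exact: ComplexField.Normc.normcM. Qed.

Lemma cabs_ge0 z : 0 <= cabs z.
Proof. by rewrite -lecR -cabsE normr_ge0. Qed.

Lemma cabsD z w : cabs (z + w) <= cabs z + cabs w.
Proof. by rewrite -lecR rmorphD /= -!cabsE ler_normD. Qed.

(* the sum of a family of complex numbers over a subset of its index type *)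
Definition csum (V : choiceType) (A : set V) (f : V -> C) : C :=
  summability.sum (fun v => (if v \in A then f v else 0) : C^o).

Context {V : choiceType}.
Implicit Types f g : V -> C.

Definition sqnorm f : \bar R := \esum_(v in [set: V]) (cabs (f v) ^+ 2)%:E.

Definition square_summable : {pred V -> C} := fun f => (sqnorm f < +oo)%E.

Lemma square_summable_submod : submod_closed square_summable.
Proof.
split.
  rewrite unfold_in /sqnorm esum1 ?ltry// => v _.
  by rewrite [(0 : V -> C) v]/(0 : C) cabs0 expr0n.
move=> a f g; rewrite !unfold_in => hf hg.
have E0 (h : V -> C) (c : R) : 0 <= c ->
    (\esum_(v in [set: V]) (c * cabs (h v) ^+ 2)%:E <= c%:E * sqnorm h)%E.
  move=> c0; apply: ge_ereal_sup => _ [X [finX _]] <-.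
  under eq_fsbigr do rewrite EFinM.
  rewrite -ge0_mule_fsumr; last by move=> v; rewrite lee_fin exprn_ge0 ?cabs_ge0.
  rewrite lee_wpmul2l ?lee_fin//.
  by apply: esum_ge; exists X.
have le1 : (sqnorm (a *: f + g)%R <=
    \esum_(v in [set: V]) ((2 * cabs a ^+ 2 * cabs (f v) ^+ 2)%:E
                           + (2 * cabs (g v) ^+ 2)%:E))%E.
  apply: le_esum => v _; rewrite -EFinD lee_fin.
  have h : cabs ((a *: f + g) v) <= cabs a * cabs (f v) + cabs (g v).
    by rewrite -cabsM; exact: cabsD.
  apply: (le_trans (lerXn2r 2 _ _ h)); rewrite ?nnegrE ?cabs_ge0//.
    by rewrite addr_ge0 ?mulr_ge0 ?cabs_ge0.
  rewrite -subr_ge0.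
  have -> : 2 * cabs a ^+ 2 * cabs (f v) ^+ 2 + 2 * cabs (g v) ^+ 2
     - (cabs a * cabs (f v) + cabs (g v)) ^+ 2
     = (cabs a * cabs (f v) - cabs (g v)) ^+ 2.
    by rewrite sqrrD sqrrB exprMn !mulr_natl !mulr2n; ring.
  exact: sqr_ge0.
apply: (le_lt_trans le1); rewrite esumD; first last.
- by move=> v _; rewrite lee_fin mulr_ge0 ?exprn_ge0 ?cabs_ge0.
- by move=> v _; rewrite lee_fin !mulr_ge0 ?exprn_ge0 ?cabs_ge0.
apply: lte_add_pinfty.
- apply: (le_lt_trans (E0 f _ _)); first by rewrite mulr_ge0 ?exprn_ge0 ?cabs_ge0.
  by rewrite lte_mul_pinfty ?lee_fin ?mulr_ge0 ?exprn_ge0 ?cabs_ge0.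
- apply: (le_lt_trans (E0 g _ _)) => //.
  by rewrite lte_mul_pinfty ?lee_fin.
Qed.

HB.instance Definition _ :=
  GRing.isSubmodClosed.Build C (V -> C) square_summable square_summable_submod.

Record ell2 := Ell2 { ell2_fun :> V -> C; ell2P : ell2_fun \in square_summable }.

HB.instance Definition _ := [isSub for ell2_fun].
HB.instance Definition _ := [Choice of ell2 by <:].
HB.instance Definition _ := [SubChoice_isSubLmodule of ell2 by <:].

Definition l2norm (f : ell2) : R := Num.sqrt (fine (sqnorm f)).

Definition l2dot (f g : ell2) : C := csum setT (fun v => f v * (g v)^*).

Definition delta (u v : V) : C := (v == u)%:R.

Lemma delta_square_summable u : delta u \in square_summable.
Proof.
rewrite unfold_in /sqnorm.
have -> : \esum_(v in [set: V]) (cabs (delta u v) ^+ 2)%:E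
   = \esum_(v in [set u]) (cabs (delta u v) ^+ 2)%:E.
  rewrite [RHS]esum_mkcond; apply: eq_esum => v _.
  case: ifPn => //; rewrite notin_setE /delta => /eqP/negPf ->.
  by rewrite cabs0 expr0n.
by rewrite esum_set1 ?ltry// lee_fin exprn_ge0 ?cabs_ge0.
Qed.

Definition e_ (u : V) : ell2 := Ell2 (delta_square_summable u).

Definition bounded_op (T : {linear ell2 -> ell2}) : Prop :=
  exists M : R, forall x, l2norm (T x) <= M * l2norm x.

Definition is_adjoint (T T' : ell2 -> ell2) : Prop :=
  forall x y, l2dot (T x) y = l2dot x (T' y).

(* T' is the Hilbert space adjoint of T; a bounded T has exactly one *)
Definition star_paranormal (T : {linear ell2 -> ell2}) : Prop :=
  bounded_op T /\
  exists T' : ell2 -> ell2, is_adjoint T T' /\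
    forall x, l2norm (T' x) ^+ 2 <= l2norm (T (T x)) * l2norm x.

(* lam is only evaluated at vertices that are not roots *)
Definition wshift (E : set (V * V)) (lam : V -> C) (f : V -> C) : V -> C :=
  fun v => if v \in nonroot E then lam v * f (par E v) else 0.

End Ell2.

Arguments ell2 R V : clear implicits.

(* Main.v *)
(* Evaluating [S e_u] gives [|(S^* f)(u)| = |\sum_(v in chi u) conj(lam v) f v|],
   and the vectors [S^2 e_u] have disjoint supports, so that
   [||S^2 f||^2 = \sum_u ||S^2 e_u||^2 |f u|^2]; the inequality is the square of
   the defining inequality of *-paranormality at [f]. *)
Require Import Defs.
From mathcomp Require Import all_boot all_order all_algebra.
From mathcomp Require Import complex finmap.
From mathcomp Require Import all_classical all_reals all_analysis.
From mathcomp Require summability.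
Import Order.TTheory GRing.Theory Num.Theory.
Local Open Scope classical_set_scope.
Local Open Scope complex_scope.
Local Open Scope ring_scope.

Lemma esumZl (R : realType) (T : choiceType) (I : set T) (c : R)
    (a : T -> \bar R) : 0 <= c -> (forall i, (0 <= a i)%E) ->
  (\esum_(i in I) (c%:E * a i) = c%:E * \esum_(i in I) a i)%E.
Proof.
move=> c0 a0; rewrite /esum -ereal_supZl//; last first.
  by apply/set0P; exists 0%E, set0; [exact: fsets_set0|rewrite fsbig_set0].
congr (ereal_sup _); rewrite image_comp.
by apply: eq_imagel => X _ /=; rewrite ge0_mule_fsumr.
Qed.

(** Both iterated sums are sums over pairs, and swapping coordinates is a bijection between the two
    index sets. *)
Lemma exchange_esum (R : realType) (T1 T2 : choiceType)
    (a : T1 -> T2 -> \bar R) : (forall i j, (0 <= a i j)%E) ->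
  (\esum_(i in [set: T1]) \esum_(j in [set: T2]) a i j =
   \esum_(j in [set: T2]) \esum_(i in [set: T1]) a i j)%E.
Proof.
move=> a0; rewrite !esum_esum//.
apply: (@reindex_esum _ _ _ _ _ (fun k : T2 * T1 => (k.2, k.1))
  (fun k => a k.1 k.2)).
by split=> [[i j]//|[i j] [k l] _ _ [-> ->]//|[i j] _]; exists (j, i).
Qed.

Section Complex.
Context {R : realType}.

Lemma cabsJ (z : R[i]) : cabs z^* = cabs z.
Proof. by apply: complexI; rewrite -!cabsE norm_conjC. Qed.

Lemma cvg_conj (T : Type) (F : set_system T) {FF : Filter F} (g : T -> R[i]^o)
    (l : R[i]^o) :
  g @ F --> l -> (fun t => (g t)^* : R[i]^o) @ F --> (l^* : R[i]^o).
Proof.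
move=> /cvgrPdist_lt gl; apply/cvgrPdist_lt => e /gl.
by apply: filterS => t; rewrite -rmorphB /= norm_conjC.
Qed.

Lemma csumE (V : choiceType) (A : set V) (g : V -> R[i]) :
  csum A g = csum setT (fun v => if v \in A then g v else 0).
Proof.
by rewrite /csum; under [in RHS]eq_fun do rewrite in_setT.
Qed.

(* When the partial sums of [g] diverge, so do those of its conjugate, and both
   sums are the same junk value. *)
Lemma cabs_csumJ (V : choiceType) (A : set V) (g : V -> R[i]) :
  cabs (csum A (fun v => (g v)^*)) = cabs (csum A g).
Proof.
pose F := @summability.totally V.
have FF : ProperFilter F by exact: summability.totally_filter.
pose s (h : V -> R[i]) : {fset V} -> R[i]^o :=
  summability.partial_sum (fun v => (if v \in A then h v else 0) : R[i]^o).
have sJ h : s (fun v => (h v)^*) = fun X => (s h X)^*.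
  apply/funext => X; rewrite /s /summability.partial_sum rmorph_sum /=.
  by apply: eq_bigr => v _; case: ifP => //; rewrite rmorph0.
have sK : s g = fun X => (s (fun v => (g v)^*) X)^*.
  by rewrite -sJ; congr s; apply/funext => v; rewrite conjCK.
rewrite /csum /summability.sum -/F -/(s g) -/(s (fun v => (g v)^*)).
have [cg|dg] := pselect (cvg (s g @ F)).
  suff -> : lim (s (fun v => (g v)^*) @ F) = (lim (s g @ F))^* by exact: cabsJ.
  by apply: cvg_lim; [exact: norm_hausdorff|rewrite sJ; exact: cvg_conj].
suff dgJ : ~ cvg (s (fun v => (g v)^*) @ F).
  by rewrite (dvgP dg) (dvgP dgJ).
move=> cg; apply: dg; rewrite sK.
by apply: cvgP; apply: cvg_conj; exact: cg.
Qed.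

Lemma csum_delta (V : choiceType) (u : V) (g : V -> R[i]) :
  csum setT (fun v => delta u v * g v) = g u.
Proof.
have FF : ProperFilter (@summability.totally V).
  exact: summability.totally_filter.
(* The net of partial sums is eventually constant: every finite set containing [u] already gives
   [g u]. *)
apply: (@lim_near_cst R[i]^o); first exact: norm_hausdorff.
exists [fset u]%fset => // X /=; rewrite fsub1set => uX.
rewrite /summability.partial_sum (bigD1 [` uX]%fset)//=.
rewrite in_setT /delta eqxx mul1r big1 ?addr0// => v.
by rewrite -val_eqE /= in_setT => /negPf ->; rewrite mul0r.
Qed.

End Complex.

Section Ell2.
Context {R : realType} {V : choiceType}.

Lemma sqnorm_fin_num (x : ell2 R V) : sqnorm x \is a fin_num.
Proof.
rewrite ge0_fin_numE; first exact: (ell2P x).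
by apply: esum_ge0 => v _; rewrite lee_fin exprn_ge0 ?cabs_ge0.
Qed.

Lemma l2norm_ge0 (x : ell2 R V) : 0 <= l2norm x.
Proof. exact: sqrtr_ge0. Qed.

Lemma l2norm_sqr (x : ell2 R V) : ((l2norm x ^+ 2)%:E = sqnorm x)%E.
Proof.
rewrite sqr_sqrtr ?fineK ?sqnorm_fin_num// fine_ge0//.
by apply: esum_ge0 => v _; rewrite lee_fin exprn_ge0 ?cabs_ge0.
Qed.

(** Pythagoras for a weighted composition operator: each [v] sees the single index [u = p v], so the
    images of the [delta u] have disjoint supports, and the two nonnegative sums can be exchanged in
    [\bar R]. *)
Lemma sqnorm_weighted_comp (w f : V -> R[i]) (p : V -> V) :
  (sqnorm (fun v => w v * f (p v))%R =
   \esum_(u in [set: V])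
     (cabs (f u) ^+ 2)%:E * sqnorm (fun v => w v * delta u (p v))%R)%E.
Proof.
have sq0 (z : R[i]) : 0 <= cabs z ^+ 2 by rewrite exprn_ge0 ?cabs_ge0.
transitivity (\esum_(v in [set: V]) \esum_(u in [set: V])
    ((cabs (f u) ^+ 2)%:E * (cabs (w v * delta u (p v))%R ^+ 2)%:E))%E.
  apply: eq_esum => v _.
  transitivity (\esum_(u in [set p v])
      ((cabs (f u) ^+ 2)%:E * (cabs (w v * delta u (p v))%R ^+ 2)%:E))%E.
    by rewrite esum_set1 ?mule_ge0 ?lee_fin// -EFinM -exprMn /delta eqxx mulr1
      cabsM mulrC.
  rewrite esum_mkcond; apply: eq_esum => u _; case: ifPn => //.
  rewrite notin_setE /= => /eqP; rewrite eq_sym /delta => /negPf ->.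
  by rewrite mulr0 cabs0 expr0n mule0.
rewrite exchange_esum; last by move=> v u; rewrite mule_ge0 ?lee_fin.
by apply: eq_esum => u _; rewrite esumZl// => v; rewrite lee_fin.
Qed.

(** Pairing [e_ u] with [T x] extracts the conjugate of [T x u], and adjointness moves [S] onto
    [e_ u]. Taking moduli absorbs the conjugation of the sum through [cabs_csumJ]. *)
Lemma cabs_adjoint (S T : ell2 R V -> ell2 R V) (x : ell2 R V) (u : V) :
  is_adjoint S T ->
  cabs (T x u) = cabs (csum setT (fun v => (S (e_ u) v)^* * x v)).
Proof.
move=> /(_ (e_ u) x); rewrite /l2dot csum_delta => ST.
rewrite -[LHS]cabsJ -ST -[in RHS]cabs_csumJ; congr (cabs (csum _ _)).
by apply/funext => v; rewrite rmorphM /= conjCK.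
Qed.

End Ell2.

Section Wshift.
Context {R : realType} {V : choiceType} {E : set (V * V)}.

Lemma par_edge (u v : V) : at_most_one_parent E -> E (u, v) -> par E v = u.
Proof. by move=> hE Euv; apply: xget_unique => // t /hE; apply. Qed.

(** Uniqueness of parents makes [par E v = u] equivalent to [E (u, v)] at a nonroot [v]; a root,
    where [par] is junk, is nobody's child. *)
Lemma wshift_delta (lam : V -> R[i]) (u v : V) : at_most_one_parent E ->
  wshift E lam (delta u) v = if v \in chi E u then lam v else 0.
Proof.
move=> hE; rewrite /wshift; have [/set_mem [t Etv]|vroot] := boolP (v \in nonroot E).
  rewrite (par_edge t)// /delta; have [<-|tu] := eqVneq t u.
    by rewrite mem_set// mulr1.
  rewrite mulr0 memNset//= => Euv; move: tu.
  by rewrite (hE _ _ _ Etv Euv) eqxx.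
rewrite memNset// => Euv; move: vroot; rewrite mem_set//.
by exists u.
Qed.

(** Puts the squared shift in the form handled by [sqnorm_weighted_comp]. The weight is the squared
    shift of the constant 1, which vanishes whenever [v] or its parent is a root, so junk values of
    [par] are multiplied by 0. *)
Lemma wshift2E (lam f : V -> R[i]) (v : V) :
  wshift E lam (wshift E lam f) v =
  wshift E lam (wshift E lam (fun=> 1)) v * f (par E (par E v)).
Proof.
rewrite /wshift; case: ifP => _; last by rewrite mul0r.
by case: ifP => _; rewrite ?mulr1 ?mulrA// mulr0 mul0r.
Qed.

End Wshift.

Theorem theorem2p1 (R : realType) (V : choiceType) (E : set (V * V))
    (hE : at_most_one_parent E) (lam : V -> R[i])
    (Slam : {linear ell2 R V -> ell2 R V})
    (S_shift : forall (f : ell2 R V) (v : V), Slam f v = wshift E lam f v)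
    (S_star : star_paranormal Slam) (f : ell2 R V) :
  ((\esum_(u in [set: V])
       (cabs (csum (chi E u) (fun v => (lam v)^* * f v)) ^+ 2)%:E) ^+ 2
   <= (\esum_(u in [set: V]) (l2norm (Slam (Slam (e_ u))) ^+ 2 * cabs (f u) ^+ 2)%:E)
      * (\esum_(u in [set: V]) (cabs (f u) ^+ 2)%:E))%E.
Proof.
have [_ [T [ST T_le]]] := S_star.
have Slam2E (x : ell2 R V) : Slam (Slam x) = wshift E lam (wshift E lam x) :> (V -> _).
  by apply/funext => v; rewrite S_shift; congr wshift; apply/funext => w.
have -> : (\esum_(u in [set: V])
    (cabs (csum (chi E u) (fun v => (lam v)^* * f v)) ^+ 2)%:E)%E =
    (l2norm (T f) ^+ 2)%:E.
  rewrite l2norm_sqr; apply: eq_esum => u _; congr ((_ ^+ 2)%:E).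
  (* The conjugated coordinates of [Slam (e_ u)] are the conjugated weights on [chi E u], extended
     by 0. *)
  rewrite (cabs_adjoint _ _ _ _ ST) csumE; congr (cabs (csum _ _)).
  apply/funext => v; rewrite S_shift wshift_delta//.
  by case: ifP => // _; rewrite rmorph0 mul0r.
have -> : (\esum_(u in [set: V])
    (l2norm (Slam (Slam (e_ u))) ^+ 2 * cabs (f u) ^+ 2)%:E)%E =
    (l2norm (Slam (Slam f)) ^+ 2)%:E.
  (* Here [p] is the grandparent map; the same factorization at [e_ u] then identifies each
     coefficient. *)
  rewrite l2norm_sqr Slam2E (funext (wshift2E lam f)) sqnorm_weighted_comp.
  apply: eq_esum => u _; rewrite EFinM muleC l2norm_sqr Slam2E.
  by rewrite (funext (wshift2E lam _)).
(* All three sums are now squares of real norms, so the claim descends from [\bar R] to [R], where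
   [T_le] at [f] is squared. *)
rewrite -/(sqnorm f) -l2norm_sqr -EFin_expe -EFinM lee_fin -exprMn.
by rewrite lerXn2r ?nnegrE ?mulr_ge0 ?exprn_ge0 ?l2norm_ge0.
Qed.
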